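(* Let $A\in\mathbb{R}^{m\times n}$ with $\operatorname{rank}(A)=m$ and $n\ge 4$, $b\in\mathbb{R}^m$, $c\in\mathbb{R}^n$, and consider the linear optimization problems $$(P)\ \min\{c^Tx: Ax=b,\ x\ge 0\},\qquad (D)\ \max\{b^Ty: A^Ty+s=c,\ s\ge 0\}.$$ Suppose that $(P)$ and $(D)$ are feasible, and that $\xi>0$ is such that $\|(x^*;s^* )\|_\infty\le \xi$ for some optimal solutions $x^*$ of $(P)$ and $(y^*,s^* )$ of $(D)$. Let $\epsilon>0$, $r_b^0:=b-\xi Ae$ and $r_c^0:=c-\xi e$, where $e$ is the all-one vector. Then the infeasible interior-point algorithm described in the context, run with accuracy parameter $\epsilon$, barrier update parameter $\theta=\frac{1}{22n}$ and threshold parameter $\tau=\frac1{12}$, finds an $\epsilon$-optimal solution of $(P)$ and $(D)$ after at most $$22\,n\,\log\frac{\max\{n\xi^2,\ \|r_b^0\|,\ \|r_c^0\|\}}{\epsilon}$$ iterations.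
   Context: Products, quotients, powers and square roots of vectors are componentwise; $\|\cdot\|$ is the Euclidean norm and $\log$ is the natural logarithm. A triple $(x,y,s)$ is an $\epsilon$-optimal solution of $(P)$ and $(D)$ if $\max\{x^Ts,\ \|b-Ax\|,\ \|c-A^Ty-s\|\}\le\epsilon$. The algorithm. Input: accuracy parameter $\epsilon>0$, barrier update parameter $\theta\in(0,1)$, threshold parameter $\tau>0$ (it does not enter the steps of the algorithm; it is the bound $\delta\le\tau$ maintained in the analysis for the proximity measure $\delta(v)=\frac12\left\|\frac{v-v^3}{2v^2-e}\right\|$, $v=\sqrt{xs/\mu}$). Initialization: $x:=\xi e$, $y:=0$, $s:=\xi e$, $\nu:=1$, $\mu:=\nu\xi^2=\xi^2$. While $\max\{x^Ts,\ \|b-Ax\|,\ \|c-A^Ty-s\|\}>\epsilon$, perform one iteration: (1) with $v:=\sqrt{xs/\mu}\in\mathbb{R}^n$ and $p_v:=\frac{v-v^3}{2v^2-e}$, compute the solution $(\Delta x,\Delta y,\Delta s)$ of the linear system $$A\Delta x=\theta\nu r_b^0,\qquad A^T\Delta y+\Delta s=\theta\nu r_c^0,\qquad s\,\Delta x+x\,\Delta s=\mu\, v\,p_v;$$ (2) set $(x,y,s):=(x,y,s)+(\Delta x,\Delta y,\Delta s)$; (3) set $\mu:=(1-\theta)\mu$ and $\nu:=(1-\theta)\nu$.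
   Formalization: With L = log(max{nξ²,‖r_b⁰‖,‖r_c⁰‖}/ε), the bound 22nL fails for small L (e.g. A=(1,1,1,1), b=4, c=e, ξ=1, ε=3.99); it is proved only for L ≥ 6, and for every ε the number of iterations is shown to be less than 22n·max(0,L)+3. *)

(* Defs.v *)
From HB Require Import structures.
From mathcomp Require Import all_boot all_order all_algebra.
From mathcomp Require Import all_classical all_reals all_analysis.
Set Implicit Arguments.
Unset Strict Implicit.
Unset Printing Implicit Defensive.
Import Order.TTheory GRing.Theory Num.Theory.
Import numFieldNormedType.Exports.
Local Open Scope ring_scope.

Definition dotv (R : realType) (k : nat) (u v : 'cV[R]_k) : R :=
  \sum_i u i 0 * v i 0.

(* The library norm `|u| on 'cV[R]_k is the maximum norm. *)
Definition enorm (R : realType) (k : nat) (u : 'cV[R]_k) : R :=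
  Num.sqrt (dotv u u).

Section LinearOptimization.
Variables (R : realType) (m n : nat).
Variables (A : 'M[R]_(m, n)) (b : 'cV[R]_m) (c : 'cV[R]_n).

Definition primal_feasible (x : 'cV[R]_n) : Prop :=
  A *m x = b /\ forall i, 0 <= x i 0.

Definition dual_feasible (y : 'cV[R]_m) (s : 'cV[R]_n) : Prop :=
  A^T *m y + s = c /\ forall i, 0 <= s i 0.

Definition primal_optimal (x : 'cV[R]_n) : Prop :=
  primal_feasible x /\
  forall x', primal_feasible x' -> dotv c x <= dotv c x'.

Definition dual_optimal (y : 'cV[R]_m) (s : 'cV[R]_n) : Prop :=
  dual_feasible y s /\
  forall y' s', dual_feasible y' s' -> dotv b y' <= dotv b y.

Definition eps_optimal (eps : R)
    (x : 'cV[R]_n) (y : 'cV[R]_m) (s : 'cV[R]_n) : Prop :=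
  Num.max (dotv x s)
    (Num.max (enorm (b - A *m x)) (enorm (c - A^T *m y - s))) <= eps.

End LinearOptimization.

Definition allone (R : realType) (n : nat) : 'cV[R]_n := const_mx 1.

Section Algorithm.
Variables (R : realType) (m n : nat).

(* The threshold does not enter the steps of the algorithm: it is the value
   below which its analysis keeps the proximity measure. *)
Record ipm_input := IpmInput {
  accuracy : R;
  barrier_update : R;
  threshold : R }.

Record ipm_state := IpmState {
  primal_var : 'cV[R]_n;
  dual_var : 'cV[R]_m;
  slack_var : 'cV[R]_n;
  barrier : R;
  residual_scale : R }.

Variables (A : 'M[R]_(m, n)) (b : 'cV[R]_m) (c : 'cV[R]_n) (xi : R).

Definition primal_residual0 : 'cV[R]_m := b - xi *: (A *m allone R n).
Definition dual_residual0 : 'cV[R]_n := c - xi *: allone R n.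

Definition ipm_init : ipm_state :=
  IpmState (xi *: allone R n) 0 (xi *: allone R n) (xi ^+ 2) 1.

Definition scaled_vec (x s : 'cV[R]_n) (mu : R) : 'cV[R]_n :=
  \col_i Num.sqrt (x i 0 * s i 0 / mu).

Definition search_rhs (v : 'cV[R]_n) : 'cV[R]_n :=
  \col_i ((v i 0 - v i 0 ^+ 3) / (2 * v i 0 ^+ 2 - 1)).

(* Square root and division are total in the library; these are the conditions
   under which v and p_v are meant. *)
Definition scaling_defined (x s : 'cV[R]_n) (mu : R) : Prop :=
  mu != 0 /\
  forall i, 0 <= x i 0 * s i 0 / mu /\
            2 * (scaled_vec x s mu) i 0 ^+ 2 - 1 != 0.

Definition newton_system (theta : R) (st : ipm_state)
    (d : 'cV[R]_n * 'cV[R]_m * 'cV[R]_n) : Prop :=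
  let: IpmState x _ s mu nu := st in
  let: (dx, dy, ds) := d in
  let v := scaled_vec x s mu in
  let p := search_rhs v in
  [/\ A *m dx = (theta * nu) *: primal_residual0,
      A^T *m dy + ds = (theta * nu) *: dual_residual0
    & forall i, s i 0 * dx i 0 + x i 0 * ds i 0 = mu * v i 0 * p i 0].

Definition ipm_update (theta : R) (st : ipm_state)
    (d : 'cV[R]_n * 'cV[R]_m * 'cV[R]_n) : ipm_state :=
  let: IpmState x y s mu nu := st in
  let: (dx, dy, ds) := d in
  IpmState (x + dx) (y + dy) (s + ds) ((1 - theta) * mu) ((1 - theta) * nu).

(* An iteration is possible only if v and p_v are defined and the linear
   system has exactly one solution, so the relation is functional. *)
Definition ipm_iteration (theta : R) (st st' : ipm_state) : Prop :=
  scaling_defined (primal_var st) (slack_var st) (barrier st) /\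
  exists d, unique (newton_system theta st) d /\ st' = ipm_update theta st d.

Definition stopping_test (eps : R) (st : ipm_state) : Prop :=
  eps_optimal A b c eps (primal_var st) (dual_var st) (slack_var st).

(* u 0, ..., u k are the successive states of an execution that enters the
   loop body exactly k times; u is irrelevant beyond k. *)
Definition ipm_halts_after (inp : ipm_input) (k : nat)
    (u : nat -> ipm_state) : Prop :=
  [/\ u 0%N = ipm_init,
      forall j, (j < k)%N ->
        ~ stopping_test (accuracy inp) (u j) /\
        ipm_iteration (barrier_update inp) (u j) (u j.+1)
    & stopping_test (accuracy inp) (u k)].

Definition initial_error : R :=
  Num.max (n%:R * xi ^+ 2)
    (Num.max (enorm primal_residual0) (enorm dual_residual0)).

End Algorithm.

(* Main.v *)
Require Import Defs.
From mathcomp Require Import all_boot all_order all_algebra.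
From mathcomp Require Import all_classical all_reals all_analysis.
From mathcomp Require Import ring lra.
Import Order.TTheory GRing.Theory Num.Theory.
Import numFieldNormedType.Exports.
Local Open Scope ring_scope.

Set Implicit Arguments.
Unset Strict Implicit.
Unset Printing Implicit Defensive.

(* Write t_i = x_i s_i / mu (the square of v_i), alpha_i = dx_i / x_i and
   beta_i = ds_i / s_i.  The Newton system gives
   alpha_i + beta_i = (1 - t_i) / (2 t_i - 1), so that 4 delta(v)^2 is the sum
   of the t_i (alpha_i + beta_i)^2 (prox_term t_i below), and the ratio after the step is
   (1 + (2 t_i - 1) (alpha_i + beta_i)^2 + t_i alpha_i beta_i) / (1 - theta).
   The second-order terms t_i alpha_i beta_i are small because
   dx - theta nu (x* - xi e) is orthogonal to ds - theta nu (s* - xi e), and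
   because nu xi e + (1 - nu) x* - x is orthogonal to
   nu xi e + (1 - nu) s* - s, which together with the complementarity of x* and
   s* bounds |x|_1 + |s|_1 by a multiple of n xi.  Hence 4 delta(v)^2 <= 1/50 is
   preserved, which is stronger than delta(v) <= 1/12.  After a step x^T s is at
   most mu (n + 1/25) with the old mu, so the error lags by one iteration behind
   the geometric decrease.  As -log (1 - theta) >= theta + theta^2/2, the
   second-order term saves about L/2 >= 3 iterations, which pays for the lag and
   for rounding up. *)

(** * Farkas' lemma and linear programming duality *)

(** Induction on the number of inequalities. If the last one is redundant, it gets multiplier 0;
    otherwise some [x0] satisfies the others with [g x0 > 0], and projecting along [x0] onto the
    kernel of [a k] removes one inequality. *)
Lemma farkas (R : realFieldType) (V : lmodType R) (k : nat)
    (a : nat -> V -> R) (g : V -> R) :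
    (forall i, scalar (a i)) -> scalar g ->
    (forall v, (forall i, (i < k)%N -> a i v <= 0) -> g v <= 0) ->
  exists2 l : nat -> R, (forall i, 0 <= l i)
    & forall v, g v = \sum_(i < k) l i * a i v.
Proof.
elim: k a g => [|k IHk] a g a_lin g_lin ag.
  exists (fun=> 0) => // v; rewrite big_ord0.
  have gN : g (- v) = - g v.
    have g0 : g 0 = 0.
      have /eqP := g_lin 1 0 0; rewrite scale1r addr0 mul1r.
      by rewrite -subr_eq subrr eq_sym => /eqP.
    by have := g_lin (-1) v 0; rewrite g0 scaleN1r !addr0 mulN1r.
  have g_le0 w : g w <= 0 by apply: ag.
  by have := g_le0 v; have := g_le0 (- v); rewrite gN; lra.
have [/IHk[] // l l_ge0 gE|] :=
  pselect (forall v, (forall i, (i < k)%N -> a i v <= 0) -> g v <= 0).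
  exists (fun i => if i == k then 0 else l i) => [i|v]; first by case: eqP.
  rewrite big_ord_recr /= eqxx mul0r addr0 gE.
  by apply: eq_bigr => i _; rewrite ltn_eqF.
move=> /existsNP[x0 /not_implyP[ax0 /negP]]; rewrite -ltNge => gx0.
have akx0 : 0 < a k x0.
  rewrite ltNge; apply/negP => akx0; move: gx0; rewrite ltNge => /negP; apply.
  by apply: ag => i; rewrite ltnS leq_eqVlt => /orP[/eqP->|/ax0].
(* Restrict to the hyperplane [a k = 0] by projecting along [x]. *)
have linB f (f_lin : scalar f) (r : R) (u w : V) : f (u - r *: w) = f u - r * f w.
  by rewrite [u - _]addrC -scaleNr f_lin mulNr [LHS]addrC.
pose x := (a k x0)^-1 *: x0.
have f_x f : scalar f -> f x = (a k x0)^-1 * f x0.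
  move=> f_lin; have f0 : f 0 = 0.
    have /eqP := f_lin 1 0 0; rewrite scale1r addr0 mul1r.
    by rewrite -subr_eq subrr eq_sym => /eqP.
  by have := f_lin (a k x0)^-1 x0 0; rewrite f0 !addr0.
pose pr v := v - a k v *: x.
have pr_lin r u w : pr (r *: u + w) = r *: pr u + pr w.
  by rewrite /pr a_lin scalerDl scalerBr -scalerA opprD addrACA.
have [|||l l_ge0 gE] := IHk (fun i v => a i (pr v)) (g \o pr).
- by move=> i r u w /=; rewrite pr_lin a_lin.
- by move=> r u w /=; rewrite pr_lin g_lin.
- move=> v av; apply: ag => i; rewrite ltnS leq_eqVlt => /orP[/eqP->|/av//].
  by rewrite linB // f_x // mulVf ?gt_eqF// mulr1 subrr.
(* The last multiplier makes the identity hold along [x], where [a k] equals 1. It is nonnegative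
   because [g x0] is positive while [a j x0 <= 0] for [j < k]. *)
exists (fun i => if i == k then g x - \sum_(j < k) l j * a j x else l i) => [i|v].
  case: eqP => // _; rewrite subr_ge0 (le_trans (y := 0)) //.
    apply: sumr_le0 => j _; rewrite mulr_ge0_le0 // f_x //.
    by rewrite pmulr_rle0 ?invr_gt0 // ax0.
  by rewrite f_x //; apply: mulr_ge0; rewrite ?invr_ge0 ltW.
rewrite big_ord_recr /= eqxx.
have := gE v; rewrite /= linB // => /eqP; rewrite subr_eq => /eqP ->.
rewrite mulrBl mulr_suml [a k v * g x]mulrC [RHS]addrCA [LHS]addrC.
congr (_ + _).
rewrite -sumrB; apply: eq_bigr => i _.
by rewrite ltn_eqF // linB //; ring.
Qed.

Section Duality.
Variables (R : realType) (m n : nat).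
Variables (A : 'M[R]_(m, n)) (b : 'cV[R]_m) (c : 'cV[R]_n).

Lemma dotvC k (u v : 'cV[R]_k) : dotv u v = dotv v u.
Proof. by apply: eq_bigr => i _; rewrite mulrC. Qed.

Lemma dotvDl k (u v w : 'cV[R]_k) : dotv (u + v) w = dotv u w + dotv v w.
Proof.
by rewrite /dotv -big_split; apply: eq_bigr => i _; rewrite mxE mulrDl.
Qed.

Lemma dotvZl k (a : R) (u w : 'cV[R]_k) : dotv (a *: u) w = a * dotv u w.
Proof. by rewrite /dotv mulr_sumr; apply: eq_bigr => i _; rewrite mxE mulrA. Qed.

Lemma dotv_trmx (y : 'cV[R]_m) (x : 'cV[R]_n) :
  dotv (A^T *m y) x = dotv y (A *m x).
Proof.
rewrite /dotv; under eq_bigr do rewrite mxE mulr_suml.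
rewrite exchange_big; apply: eq_bigr => i _; rewrite mxE mulr_sumr.
by apply: eq_bigr => j _; rewrite mxE; ring.
Qed.

(** Farkas' lemma is applied to the homogenized dual: [A^T z <= r c] and [0 <= r] imply
    [b^T z <= r b^T y], by rescaling [z] if [r > 0] and by moving from [y] along [z] if [r = 0]. The
    first [n] multipliers form a primal feasible point, and evaluation at [(0, 1)] shows that its
    cost is at most [b^T y]. *)
Lemma strong_duality (x : 'cV[R]_n) (y : 'cV[R]_m) (s : 'cV[R]_n) :
    primal_optimal A b c x -> dual_optimal A b c y s -> dotv c x <= dotv b y.
Proof.
move=> [_ xopt] [[Ays s_ge0] yopt].
pose V := ('cV[R]_m * R^o)%type.
(* Indices below [n] give the dual inequalities; at index [n], [insub] fails and the default value
   encodes [0 <= r]. *)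
pose a i (v : V) :=
  oapp (fun j : 'I_n => (A^T *m v.1) j 0 - v.2 * c j 0) (- v.2) (insub i).
pose g (v : V) := dotv v.1 b - v.2 * dotv b y.
have a_lin i : scalar (a i).
  move=> r u w; rewrite /a; case: insub => [j|] /=.
    by rewrite mulmxDr -scalemxAr !mxE /GRing.scale /=; ring.
  by rewrite /GRing.scale /=; ring.
have g_lin : scalar g.
  by move=> r u w; rewrite /g dotvDl dotvZl /= -[_ *: u.2]/(r * u.2 : R); ring.
have [|l l_ge0 gE] := farkas (k := n.+1) a_lin g_lin.
  move=> [z r] av.
  have Az j : (A^T *m z) j 0 <= r * c j 0.
    have := av j; rewrite /a valK /= ltnS ltnW //.
    by move=> /(_ isT); rewrite subr_le0.
  have r_ge0 : 0 <= r.
    by have := av n (ltnSn n); rewrite /a insubN ?ltnn //= oppr_le0.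
  have feas (w : 'cV[R]_m) :
      (forall j, (A^T *m w) j 0 <= c j 0) -> dotv b w <= dotv b y.
    move=> Aw; apply: (yopt w (c - A^T *m w)); split; first by rewrite addrC subrK.
    by move=> j; rewrite !mxE in Aw *; have := Aw j; rewrite !mxE subr_ge0.
  rewrite /g /= dotvC subr_le0.
  have [r0|r_neq0] := eqVneq r 0.
    have := feas (y + z); rewrite dotvC dotvDl !(dotvC _ b) r0 mul0r gerDl.
    apply => j; rewrite mulmxDr -Ays [leLHS]mxE [leRHS]mxE lerD2l.
    by rewrite (le_trans (Az j)) // r0 mul0r.
  have r_gt0 : 0 < r by rewrite lt_def r_neq0.
  have := feas (r^-1 *: z); rewrite dotvC dotvZl dotvC mulrC ler_pdivrMr // mulrC.
  by apply => j; rewrite -scalemxAr mxE mulrC ler_pdivrMr // mulrC.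
have lam : primal_feasible A b (\col_i l i).
  split=> [|i]; last by rewrite mxE.
  apply/colP => i.
  have := gE (delta_mx i 0, 0); rewrite /g mul0r subr0.
  rewrite {1}/dotv (bigD1 i) //= big1 ?addr0 => [|j ji]; last first.
    by rewrite !mxE (negbTE ji) mul0r.
  rewrite mxE !eqxx mul1r => ->; rewrite big_ord_recr /= /a insubN ?ltnn //=.
  rewrite oppr0 mulr0 addr0 mxE; apply: eq_bigr => j _.
  rewrite valK /= mul0r subr0 !mxE (bigD1 i) //= big1 => [|q qi].
    by rewrite !mxE !eqxx /= addr0 mulr1 mulrC.
  by rewrite !mxE (negbTE qi) mulr0.
apply: le_trans (xopt _ lam) _.
have := gE (0, 1); rewrite /g big_ord_recr /= {2}/a insubN ?ltnn //= !mul1r.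
rewrite /dotv [X in X - _]big1 => [|i _]; last by rewrite mxE mul0r.
have -> : \sum_(i < n) l i * a i (0, 1) = - \sum_i c i 0 * (\col_i l i) i 0.
  rewrite -sumrN; apply: eq_bigr => i _; rewrite /a valK /= mulmx0 !mxE.
  ring.
have := l_ge0 n; lra.
Qed.

(** The duality gap is [dotv s x], a sum of nonnegative terms that strong duality makes
    nonpositive. *)
Lemma complementary_slackness (x : 'cV[R]_n) (y : 'cV[R]_m) (s : 'cV[R]_n) :
    primal_optimal A b c x -> dual_optimal A b c y s ->
  forall i, x i 0 * s i 0 = 0.
Proof.
move=> xopt yopt; have := strong_duality xopt yopt.
case: xopt yopt => [[Ax x_ge0] _] [[<- s_ge0] _].
rewrite dotvDl dotv_trmx Ax [dotv y b]dotvC gerDl => sx_le0 i.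
have t_ge0 j : 0 <= s j 0 * x j 0 by rewrite mulr_ge0.
have : dotv s x = 0 by apply/eqP; rewrite eq_le sx_le0 sumr_ge0.
rewrite mulrC => /eqP; rewrite psumr_eq0 // => /allP/(_ i).
by rewrite mem_index_enum => /(_ isT)/eqP.
Qed.
End Duality.

(** * Scalar estimates *)

Definition prox_term (R : realFieldType) (t : R) : R :=
  t * ((1 - t) / (2 * t - 1)) ^+ 2.

Lemma prox_term_ge0 (R : realFieldType) (t : R) : 0 <= t -> 0 <= prox_term t.
Proof. by move=> t_ge0; rewrite mulr_ge0 // sqr_ge0. Qed.

(** Clearing denominators leaves a cubic inequality. The cubic is [t - 87/100], respectively
    [t - 118/100], times a quadratic of known sign, plus a small positive remainder. The condition
    [1 / 2 < t] excludes the [t] near 0, where [prox_term] is small too. *)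
Lemma prox_term_small (R : realFieldType) (t : R) :
  1 / 2 < t -> prox_term t <= 1 / 50 -> 87 / 100 <= t <= 118 / 100.
Proof.
move=> t_gt; rewrite /prox_term expr_div_n mulrA ler_pdivrMr; last first.
  by rewrite exprn_gt0 //; lra.
move=> h; have {}h : t ^+ 3 - 208 / 100 * t ^+ 2 + 108 / 100 * t - 2 / 100 <= 0.
  rewrite -subr_le0 in h; apply: le_trans h; rewrite le_eqVlt; apply/orP; left.
  by apply/eqP; field.
apply/andP; split; rewrite leNgt; apply/negP => ht.
  have q_lt0 : t ^+ 2 - 121 / 100 * t + 273 / 10000 < 0 by nra.
  have : 0 < (t - 87 / 100) * (t ^+ 2 - 121 / 100 * t + 273 / 10000).
    by rewrite nmulr_rgt0 // subr_lt0.
  by lra.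
have q_gt0 : 0 < t ^+ 2 - 9 / 10 * t + 18 / 1000 by nra.
have : 0 < (t - 118 / 100) * (t ^+ 2 - 9 / 10 * t + 18 / 1000).
  by rewrite mulr_gt0 // subr_gt0.
by lra.
Qed.

Lemma sum_sqr_le (R : realFieldType) (I : finType) (a : I -> R) :
  (forall i, 0 <= a i) -> \sum_i a i ^+ 2 <= (\sum_i a i) ^+ 2.
Proof.
move=> a_ge0; rewrite [X in _ <= X]expr2 mulr_suml; apply: ler_sum => i _.
by rewrite expr2 ler_wpM2l // (bigD1 i) //= lerDl sumr_ge0.
Qed.

(** The difference [f] of the two sides vanishes at 0 and has a nonpositive derivative because
    [(1 + x)(1 - x) <= 1]. *)
Lemma ln1B_le (R : realType) (t : R) : 0 <= t < 1 ->
  ln (1 - t) <= - t - t ^+ 2 / 2.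
Proof.
move=> /andP[t_ge0 t_lt1].
pose f (x : R) := ln (1 - x) + (x + x * x / 2).
have f' (x : R) : x < 1 -> is_derive x 1 f (- (1 - x)^-1 + (1 + x)).
  move=> x1.
  have hln : is_derive (1 - x) 1 (@ln R) (1 - x)^-1.
    by apply: is_derive1_ln; rewrite subr_gt0.
  have h1 : is_derive x 1 (fun x : R => 1 - x) (- 1).
    by apply: is_derive_eq; rewrite add0r mul1r.
  have h2 : is_derive x 1 (fun x : R => ln (1 - x)) (- (1 - x)^-1).
    by apply: is_derive_eq; rewrite /GRing.scale /= mulrN1.
  have h3 : is_derive x 1 (fun x : R => x + x * x / 2) (1 + x).
    by apply: is_derive_eq; rewrite /GRing.scale /=; field.
  exact: is_deriveD.
have : f t <= f 0.
  apply: (@ler0_derive1_le_cc R f 0 t) => //.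
  - by move=> x; rewrite in_itv /= => /andP[_ /lt_trans/(_ t_lt1)/f'[]].
  - move=> x; rewrite in_itv /= => /andP[x_gt0 /lt_trans/(_ t_lt1) x_lt1].
    have df := f' _ x_lt1; rewrite derive1E derive_val.
    have : 0 < 1 - x by rewrite subr_gt0.
    move=> x1; rewrite addrC subr_le0 -[leRHS]mul1r ler_pdivlMr //; nra.
  - apply: derivable_within_continuous => x; rewrite in_itv /=.
    by move=> /andP[_ /le_lt_trans/(_ t_lt1)/f'[]].
  - by rewrite in_itv /= lexx t_ge0.
  - by rewrite in_itv /= lexx t_ge0.
by rewrite /f /= subr0 ln1; lra.
Qed.

(** * One Newton step in relative coordinates *)

Section Step.
Variables (R : realFieldType) (n : nat).
Hypothesis n_ge4 : (4 <= n)%N.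
Let N : R := n%:R.
Let theta : R := 1 / (22 * N).

Let N_ge4 : 4 <= N. Proof. by rewrite /N ler_nat. Qed.
Let theta_N : 22 * N * theta = 1.
Proof. by rewrite /theta mul1r mulfV // mulf_neq0 ?gt_eqF //; have := N_ge4; lra. Qed.
Let theta_gt0 : 0 < theta.
Proof. by rewrite /theta divr_gt0 // mulr_gt0 //; have := N_ge4; lra. Qed.
Let theta_le : theta <= 1 / 88.
Proof. by have := theta_N; have := N_ge4; have := theta_gt0; nra. Qed.

(** With [X] and [S] as in the proof, [X s + S x = x s + X S - (X - x)(S - s)]. Both [X] and [S] are
    at least [nu xi], and [X S <= nu xi^2] because one of [xs i], [ss i] is zero. *)
Lemma coordinate_sum_le (x s xs ss : 'I_n -> R) (xi nu : R) :
    0 < xi -> 0 < nu <= 1 ->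
    (forall i, [/\ 0 < x i, 0 < s i, 0 <= xs i <= xi, 0 <= ss i <= xi
      & xs i * ss i = 0]) ->
    \sum_i (nu * xi + (1 - nu) * xs i - x i) *
           (nu * xi + (1 - nu) * ss i - s i) = 0 ->
  nu * xi * \sum_i (x i + s i) <= \sum_i x i * s i + N * (nu * xi ^+ 2).
Proof.
move=> xi_gt0 /andP[nu_gt0 nu_le1] h orth.
have -> : N * (nu * xi ^+ 2) = \sum_(i < n) nu * xi ^+ 2.
  by rewrite sumr_const card_ord mulr_natl.
suff pt i : nu * xi * (x i + s i) <= x i * s i + nu * xi ^+ 2 -
    (nu * xi + (1 - nu) * xs i - x i) * (nu * xi + (1 - nu) * ss i - s i).
  have := @ler_sum _ _ (index_enum 'I_n) xpredT _ _ (fun i _ => pt i).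
  by rewrite -mulr_sumr sumrB orth subr0 [leRHS]big_split.
have [x_gt0 s_gt0 /andP[xs_ge0 xs_le] /andP[ss_ge0 ss_le] xss] := h i.
set X := nu * xi + (1 - nu) * xs i; set S := nu * xi + (1 - nu) * ss i.
have Xs : 0 <= (X - nu * xi) * s i.
  by rewrite /X addrC addKr; rewrite !mulr_ge0 // ?subr_ge0 // ltW.
have Sx : 0 <= (S - nu * xi) * x i.
  by rewrite /S addrC addKr; rewrite !mulr_ge0 // ?subr_ge0 // ltW.
have : X * S <= nu * xi ^+ 2.
  have -> : X * S = nu * xi * (nu * xi + (1 - nu) * (xs i + ss i)) +
      (1 - nu) ^+ 2 * (xs i * ss i).
    by rewrite /X /S; ring.
  rewrite xss mulr0 addr0 expr2 [leRHS]mulrA ler_pM2l ?mulr_gt0 //.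
  have : xs i + ss i <= xi.
    by have /eqP := xss; rewrite mulf_eq0 => /orP[] /eqP->; rewrite ?add0r ?addr0.
  nra.
lra.
Qed.

(* Summed over the coordinates, the last term vanishes by orthogonality. *)
Lemma rel_step_bound (t al be phi ga : R) : 0 <= t ->
  t * (al ^+ 2 + be ^+ 2) <=
  3 / 2 * (t * (al + be) ^+ 2) + 6 * (t * (phi ^+ 2 + ga ^+ 2))
  - 3 * (t * ((al - phi) * (be - ga))).
Proof.
move=> t_ge0; rewrite -subr_ge0.
set X := (X in 0 <= X).
have -> : X = t / 2 * ((al + 3 * ga) ^+ 2 + (be + 3 * phi) ^+ 2 + 3 * (phi - ga) ^+ 2).
  by rewrite /X; field.
apply: mulr_ge0; first lra.
by apply: addr_ge0; [apply: addr_ge0|apply: mulr_ge0] => //; exact: sqr_ge0.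
Qed.

(** Here [|z - xi| <= xi], and the lower bound on the ratio gives [nu / x <= 100/87 s / xi^2]. So
    the primal displacement is controlled by the slack, and conversely after exchanging [x] and
    [s]. *)
Lemma target_term_le (x s z xi nu : R) :
    0 < x -> 0 < s -> 0 < xi -> 0 < nu -> 0 <= z <= xi ->
    87 / 100 <= x * s / (nu * xi ^+ 2) ->
  x * s / (nu * xi ^+ 2) * (theta * nu * (z - xi) / x) ^+ 2 <=
  theta ^+ 2 / xi ^+ 2 * (100 / 87) * s ^+ 2.
Proof.
move=> x_gt0 s_gt0 xi_gt0 nu_gt0 /andP[z_ge0 z_le] t_ge.
have mu_gt0 : 0 < nu * xi ^+ 2 by rewrite mulr_gt0 ?exprn_gt0.
apply: le_trans (_ : theta ^+ 2 * (nu * (s / x)) <= _).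
  have -> : x * s / (nu * xi ^+ 2) * (theta * nu * (z - xi) / x) ^+ 2 =
      theta ^+ 2 * (nu * (s / x)) * ((z - xi) ^+ 2 / xi ^+ 2).
    by field; rewrite !gt_eqF.
  apply: ler_piMr; first by rewrite mulr_ge0 ?sqr_ge0 // mulr_ge0 ?divr_ge0 // ltW.
  rewrite ler_pdivrMr ?exprn_gt0 // mul1r; nra.
have -> : theta ^+ 2 / xi ^+ 2 * (100 / 87) * s ^+ 2 =
    theta ^+ 2 * (100 / 87 * s ^+ 2 / xi ^+ 2) by field; rewrite gt_eqF.
apply: ler_wpM2l; first exact: sqr_ge0.
rewrite ler_pdivlMr // in t_ge.
rewrite mulrA ler_pdivrMr // mulrAC ler_pdivlMr ?exprn_gt0 //.
nra.
Qed.

Lemma target_sum_le (x s xs ss : 'I_n -> R) (xi nu : R) :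
    0 < xi -> 0 < nu <= 1 ->
    (forall i, [/\ 0 < x i, 0 < s i, 0 <= xs i <= xi, 0 <= ss i <= xi
      & xs i * ss i = 0]) ->
    \sum_i (nu * xi + (1 - nu) * xs i - x i) *
           (nu * xi + (1 - nu) * ss i - s i) = 0 ->
    (forall i, 87 / 100 <= x i * s i / (nu * xi ^+ 2) <= 118 / 100) ->
  \sum_i x i * s i / (nu * xi ^+ 2) *
     ((theta * nu * (xs i - xi) / x i) ^+ 2 + (theta * nu * (ss i - xi) / s i) ^+ 2)
  <= 115 / 10000.
Proof.
move=> xi_gt0 nu01 h orth t_bnd; have /andP[nu_gt0 _] := nu01.
have mu_gt0 : 0 < nu * xi ^+ 2 by rewrite mulr_gt0 ?exprn_gt0.
have xs_ge0 i : 0 <= x i + s i by have [? ? _ _ _] := h i; rewrite addr_ge0 ?ltW.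
apply: le_trans (_ : theta ^+ 2 / xi ^+ 2 * (100 / 87) *
  (\sum_i (x i + s i)) ^+ 2 <= _).
  apply: le_trans (_ : theta ^+ 2 / xi ^+ 2 * (100 / 87) *
    (\sum_i (x i + s i) ^+ 2) <= _); last first.
    by rewrite ler_wpM2l ?sum_sqr_le // mulr_ge0 ?divr_ge0 ?sqr_ge0.
  rewrite mulr_sumr; apply: ler_sum => i _.
  have [x_gt0 s_gt0 xsb ssb _] := h i; have /andP[t_ge _] := t_bnd i.
  have hx := target_term_le x_gt0 s_gt0 xi_gt0 nu_gt0 xsb t_ge.
  have hs := target_term_le s_gt0 x_gt0 xi_gt0 nu_gt0 ssb.
  rewrite mulrDr; apply: le_trans (lerD hx _) _.
    by rewrite [x i * s i]mulrC in t_ge *; exact: hs.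
  rewrite -mulrDr; apply: ler_wpM2l; first by rewrite mulr_ge0 ?divr_ge0 ?sqr_ge0.
  have := mulr_gt0 x_gt0 s_gt0; lra.
(* The constant is 118/100, from the products [x i * s i], plus 1, from the last term of
   [coordinate_sum_le]. *)
have sum_le : \sum_i (x i + s i) <= 218 / 100 * (N * xi).
  rewrite -(ler_pM2l (_ : 0 < nu * xi)) ?mulr_gt0 //.
  apply: le_trans (coordinate_sum_le xi_gt0 nu01 h orth) _.
  have -> : nu * xi * (218 / 100 * (N * xi)) =
      N * (118 / 100 * (nu * xi ^+ 2)) + N * (nu * xi ^+ 2) by field.
  rewrite lerD2r; have -> : N * (118 / 100 * (nu * xi ^+ 2)) =
      \sum_(i < n) 118 / 100 * (nu * xi ^+ 2).
    by rewrite sumr_const card_ord -[RHS]mulr_natl.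
  apply: ler_sum => i _; have /andP[_] := t_bnd i.
  by rewrite ler_pdivrMr.
apply: le_trans (_ : theta ^+ 2 / xi ^+ 2 * (100 / 87) *
  (218 / 100 * (N * xi)) ^+ 2 <= _).
  apply: ler_wpM2l; first by rewrite mulr_ge0 ?divr_ge0 ?sqr_ge0.
  rewrite ler_sqr ?nnegrE ?sumr_ge0 //.
  by rewrite (le_trans _ sum_le) ?sumr_ge0.
(* Here [theta] of order [1/n] matters: [22 N theta = 1] absorbs [N]. *)
have -> : theta ^+ 2 / xi ^+ 2 * (100 / 87) * (218 / 100 * (N * xi)) ^+ 2 =
    (22 * N * theta) ^+ 2 * ((218 / 2200) ^+ 2 * (100 / 87)).
  by field; rewrite gt_eqF.
rewrite theta_N; lra.
Qed.

Section OneStep.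
Variables t al be : 'I_n -> R.
Hypothesis t_gt : forall i, 1 / 2 < t i.
Hypothesis prox : \sum_i prox_term (t i) <= 1 / 50.
Hypothesis al_be : forall i, al i + be i = (1 - t i) / (2 * t i - 1).
Let E := \sum_i t i * (al i ^+ 2 + be i ^+ 2).
Hypothesis E_le : E <= 1 / 10.
Let tn i := t i * ((1 + al i) * (1 + be i)) / (1 - theta).


Let t_bnd i : 87 / 100 <= t i <= 118 / 100.
Proof.
apply: prox_term_small => //; apply: le_trans prox.
rewrite (bigD1 i) //= lerDl sumr_ge0 // => j _; rewrite prox_term_ge0 //.
by have := t_gt j; lra.
Qed.

Lemma kappa_abs_sum_le : \sum_i `|t i * (al i * be i)| <= 1 / 20.
Proof.
have : \sum_i `|t i * (al i * be i)| <= E / 2.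
  rewrite /E mulr_suml; apply: ler_sum => i _.
  have := t_bnd i; move=> /andP[t1 t2].
  rewrite ler_norml; apply/andP; split.
    have := sqr_ge0 (al i + be i); nra.
  have := sqr_ge0 (al i - be i); nra.
by move/le_trans; apply; move: E_le; rewrite ler_pdivrMr //; lra.
Qed.
Let kap i := t i * (al i * be i).
Let a i := (2 * t i - 1) * ((1 - t i) / (2 * t i - 1)) ^+ 2.

Let a_ge0 i : 0 <= a i.
Proof. by rewrite mulr_ge0 ?sqr_ge0 //; have := t_gt i; lra. Qed.

Let a_sum : \sum_i a i <= 1 / 43.
Proof.
(* The quotient of [a i] by [prox_term (t i)] is [2 - 1/t], at most 58/50 for [t <= 118/100]. *)
apply: le_trans (_ : (58 / 50) * \sum_i prox_term (t i) <= _); last first.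
  have := prox; lra.
rewrite mulr_sumr; apply: ler_sum => i _; rewrite /a /prox_term [leRHS]mulrA.
apply: ler_wpM2r; first exact: sqr_ge0.
have := t_bnd i; lra.
Qed.

(** The part [t (1 + al + be)] equals [t^2 / (2 t - 1)], which is [1 + a]: its deviation from 1 is
    quadratic in [1 - t] and never negative. *)
Let tnE i : (1 - theta) * tn i = 1 + a i + kap i.
Proof.
rewrite /tn mulrC divfK; last by rewrite gt_eqF //; have := theta_le; lra.
have -> : (1 + al i) * (1 + be i) = 1 + (al i + be i) + al i * be i by ring.
rewrite al_be /a /kap; field.
by have ti := t_gt i; rewrite gt_eqF //; lra.
Qed.

Let kap_abs i : `|kap i| <= 1 / 20.
Proof.
by apply: le_trans kappa_abs_sum_le; rewrite (bigD1 i) //= lerDl sumr_ge0.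
Qed.

(** The product of the two factors is [(1 + a + kap) / t], hence positive, so they have the same
    sign. If both were negative, [al be >= 1] would contradict the bound 1/20 on [kap]. *)
Lemma step_positive i : 0 < 1 + al i /\ 0 < 1 + be i.
Proof.
have := kap_abs i; rewrite ler_norml => /andP[k1 k2].
have : 0 < (1 + al i) * (1 + be i).
  rewrite -(pmulr_rgt0 _ (_ : 0 < t i)); last by have := t_gt i; lra.
  have -> : t i * ((1 + al i) * (1 + be i)) = (1 - theta) * tn i.
    by rewrite /tn [RHS]mulrC divfK // gt_eqF //; have := theta_le; lra.
  by rewrite tnE; have := a_ge0 i; lra.
have [al_gt|al_le] := ltP 0 (1 + al i).
  by rewrite pmulr_rgt0 // => be_gt; split.
have [be_gt|be_le] := ltP 0 (1 + be i).
  by rewrite pmulr_lgt0 // ltNge al_le.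
move=> _; exfalso; have : 1 <= al i * be i by nra.
move: k2; rewrite /kap; have := t_bnd i; nra.
Qed.

Let tn_ge i : 19 / 20 <= tn i.
Proof.
have := tnE i; have := a_ge0 i; have := kap_abs i; rewrite ler_norml.
have := theta_gt0; have := theta_le; nra.
Qed.

Lemma step_ratio_gt i : 1 / 2 < tn i.
Proof. by have := tn_ge i; lra. Qed.

(** The factor 6/5 bounds [t / (2 t - 1)^2] for [t >= 19/20], and 31/10 bounds [3 / (1 - theta)^2],
    the 3 coming from the square of the three-term sum [theta + a + kap]. The total
    [6/5 31/10 (1/1936 + 1/43^2 + 1/20^2)] is below 1/50. *)
Lemma step_prox : \sum_i prox_term (tn i) <= 1 / 50.
Proof.
have pt i : prox_term (tn i) <= 6 / 5 * (tn i - 1) ^+ 2.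
  rewrite /prox_term expr_div_n mulrA ler_pdivrMr; last first.
    by rewrite exprn_gt0 //; have := tn_ge i; lra.
  have -> : (1 - tn i) ^+ 2 = (tn i - 1) ^+ 2 by ring.
  rewrite [leRHS]mulrAC ler_wpM2r ?sqr_ge0 //.
  have := tn_ge i; nra.
apply: le_trans (ler_sum _ (fun i _ => pt i)) _; rewrite -mulr_sumr.
have sq i : (tn i - 1) ^+ 2 <= 31 / 10 * (theta ^+ 2 + a i ^+ 2 + `|kap i| ^+ 2).
  have -> : tn i - 1 = (theta + a i + kap i) / (1 - theta).
    apply: (mulfI (_ : 1 - theta != 0)).
      by rewrite gt_eqF //; have := theta_le; lra.
    rewrite mulrBr tnE [RHS]mulrC divfK ?gt_eqF //; last by have := theta_le; lra.
    by ring.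
  rewrite expr_div_n ler_pdivrMr; last first.
    by rewrite exprn_gt0 //; have := theta_le; lra.
  rewrite real_normK ?num_real //.
  apply: le_trans (_ : 3 * (theta ^+ 2 + a i ^+ 2 + kap i ^+ 2) <= _).
    have := sqr_ge0 (theta - a i); have := sqr_ge0 (theta - kap i).
    have := sqr_ge0 (a i - kap i); nra.
  rewrite mulrAC ler_wpM2r ?addr_ge0 ?sqr_ge0 //.
  have := theta_le; have := theta_gt0; nra.
have := @ler_sum _ _ (index_enum 'I_n) xpredT _ _ (fun i _ => sq i).
rewrite -mulr_sumr !big_split /= sumr_const card_ord -mulr_natl -/N.
have := sum_sqr_le a_ge0.
have := sum_sqr_le (fun i => normr_ge0 (kap i)).
have : N * theta ^+ 2 <= 1 / 1936.
  have := theta_N; have := theta_le; have := theta_gt0; nra.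
have : (\sum_i a i) ^+ 2 <= (1 / 43) ^+ 2.
  by rewrite ler_sqr ?nnegrE ?sumr_ge0 //; exact: a_sum.
have : (\sum_i `|kap i|) ^+ 2 <= (1 / 20) ^+ 2.
  by rewrite ler_sqr ?nnegrE ?sumr_ge0 //; exact: kappa_abs_sum_le.
move=> *; lra.
Qed.

(** Only an upper bound on the sum of [kap] matters, and [al be <= (al + be)^2 / 2] bounds it by
    half the sum of [prox_term]; then 1/100 + 1/43 is below 1/25. *)
Lemma step_gap : \sum_i (1 - theta) * tn i <= N + 1 / 25.
Proof.
under eq_bigr do rewrite tnE.
rewrite !big_split /= sumr_const card_ord -/N.
have : \sum_i kap i <= 1 / 100.
  apply: le_trans (_ : (\sum_i prox_term (t i)) / 2 <= _);
    last by have := prox; lra.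
  rewrite mulr_suml; apply: ler_sum => i _.
  rewrite /prox_term -al_be /kap.
  have := sqr_ge0 (al i); have := sqr_ge0 (be i); have := t_gt i; nra.
by have := a_sum; lra.
Qed.
End OneStep.
End Step.

(** * Norms and unique solvability of the Newton system *)

Lemma enormZ (R : realType) k (a : R) (u : 'cV[R]_k) :
  0 <= a -> enorm (a *: u) = a * enorm u.
Proof.
move=> a_ge0; rewrite /enorm dotvZl dotvC dotvZl mulrA -expr2.
by rewrite sqrtrM ?sqr_ge0 // sqrtr_sqr ger0_norm.
Qed.

Lemma coord_le_norm (R : realType) k (u : 'cV[R]_k) i : `|u i 0| <= `|u|.
Proof.
rewrite [leRHS]/Num.norm /= mx_normrE.
exact: (le_bigmax_cond _ (fun ij : 'I_k * 'I_1 => `|u ij.1 ij.2|)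
  (j := (i, 0))).
Qed.

(** Eliminating [dx] and [ds] leaves the normal equations for [dy], with matrix [A D A^T] where [D]
    is diagonal and positive. Full row rank of [A] makes this matrix invertible. *)
Lemma newton_direction_unique (R : realType) (m n : nat) (A : 'M[R]_(m, n))
    (x s g : 'cV[R]_n) (f : 'cV[R]_m) (h : 'I_n -> R) :
    \rank A = m -> (forall i, 0 < x i 0) -> (forall i, 0 < s i 0) ->
  exists d, unique (fun d : 'cV[R]_n * 'cV[R]_m * 'cV[R]_n =>
    [/\ A *m d.1.1 = f, A^T *m d.1.2 + d.2 = g
      & forall i, s i 0 * d.1.1 i 0 + x i 0 * d.2 i 0 = h i]) d.
Proof.
move=> rankA x_gt0 s_gt0.
have freeA : row_free A by rewrite /row_free rankA.
pose D := diag_mx (\row_i (x i 0 / s i 0)).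
pose hs : 'cV_n := \col_i (h i / s i 0).
have M_unit : A *m D *m A^T \in unitmx.
  rewrite -row_free_unit -kermx_eq0; apply/rowV0P => w /sub_kermxP wM.
  apply/eqP; rewrite -(mulmx_free_eq0 _ freeA); apply/eqP.
  (* This quadratic form is a sum of squares of the entries of [w A] with positive weights, so its
     vanishing gives [w A = 0]. *)
  have : (w *m (A *m D *m A^T) *m w^T) 0 0 = 0 by rewrite wM mul0mx mxE.
  rewrite !mulmxA -(mulmxA _ A^T) -trmx_mul mul_mx_diag.
  move: (w *m A) => v; rewrite mxE => /eqP; rewrite psumr_eq0 => [/allP v0|j _].
    apply/rowP => j; have := v0 j; rewrite mem_index_enum => /(_ isT)/eqP.
    rewrite !mxE mulrAC => /eqP; rewrite mulf_eq0 => /orP[].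
      by rewrite mulf_eq0 orbb => /eqP.
    by rewrite gt_eqF // divr_gt0.
  by rewrite !mxE mulrAC mulr_ge0 // -?expr2 ?sqr_ge0 // divr_ge0 ?ltW.
have dxE (dx ds : 'cV[R]_n) :
    (forall i, s i 0 * dx i 0 + x i 0 * ds i 0 = h i) <-> dx = hs - D *m ds.
  split=> [hd|-> i].
    apply/colP => i; rewrite mul_diag_mx !mxE -hd; field.
    by rewrite gt_eqF.
  by rewrite mul_diag_mx !mxE; field; rewrite gt_eqF.
have dsE (dy : 'cV[R]_m) (ds : 'cV[R]_n) : A^T *m dy + ds = g <-> ds = g - A^T *m dy.
  by split=> [<-|->]; rewrite addrC ?addKr ?addrNK // addrK.
have dyE (dy : 'cV[R]_m) :
    A *m (hs - D *m (g - A^T *m dy)) = f <->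
    dy = invmx (A *m D *m A^T) *m (f - A *m (hs - D *m g)).
  have -> : A *m (hs - D *m (g - A^T *m dy)) =
      A *m D *m A^T *m dy + A *m (hs - D *m g).
    by rewrite -!mulmxA -mulmxDr; congr (_ *m _); rewrite mulmxBr opprB addrCA.
  by split=> [<-|->]; rewrite ?addrK ?mulKmx // mulKVmx // subrK.
pose dy := invmx (A *m D *m A^T) *m (f - A *m (hs - D *m g)).
pose ds := g - A^T *m dy.
exists (hs - D *m ds, dy, ds); split=> /=.
  by split; [apply/dyE|apply/dsE|apply/dxE].
move=> [[dx' dy'] ds'] /= [Adx /dsE ds'E /dxE dx'E].
move: Adx; rewrite dx'E ds'E => /dyE dy'E.
by rewrite /ds /dy -dy'E.
Qed.

(** * The invariant of the iterates and its preservation *)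

Section Invariant.
Variables (R : realType) (m n : nat).
Variables (A : 'M[R]_(m, n)) (b : 'cV[R]_m) (c : 'cV[R]_n) (xi : R).
Hypothesis rankA : \rank A = m.
Hypothesis n_ge4 : (4 <= n)%N.
Hypothesis xi_gt0 : 0 < xi.
Let theta : R := 1 / (22 * n%:R).

Definition ratio (st : ipm_state R m n) (i : 'I_n) : R :=
  primal_var st i 0 * slack_var st i 0 / barrier st.

(** [inv_ratio] keeps the ratios beyond the pole 1/2 of the Newton right-hand side; together with
    [inv_prox] it places them near 1. *)
Record ipm_invariant (st : ipm_state R m n) : Prop := IpmInvariant {
  inv_primal_gt0 : forall i, 0 < primal_var st i 0;
  inv_slack_gt0 : forall i, 0 < slack_var st i 0;
  inv_barrier : barrier st = residual_scale st * xi ^+ 2;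
  inv_scale : 0 < residual_scale st <= 1;
  inv_primal_residual :
    b - A *m primal_var st = residual_scale st *: primal_residual0 A b xi;
  inv_dual_residual :
    c - A^T *m dual_var st - slack_var st = residual_scale st *: dual_residual0 c xi;
  inv_ratio : forall i, 1 / 2 < ratio st i;
  inv_prox : \sum_i prox_term (ratio st i) <= 1 / 50 }.

Lemma invariant_init : ipm_invariant (ipm_init m n xi).
Proof.
have xi2 : xi ^+ 2 != 0 by rewrite gt_eqF // exprn_gt0.
have r1 i : ratio (ipm_init m n xi) i = 1.
  by rewrite /ratio /= !mxE !mulr1 -expr2 divff.
split=> //=.
- by move=> i; rewrite !mxE mulr1.
- by move=> i; rewrite !mxE mulr1.
- by rewrite mul1r.
- by rewrite ltr01 lexx.
- by rewrite scale1r -scalemxAr.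
- by rewrite scale1r mulmx0 subr0.
- by move=> i; rewrite r1; lra.
- by rewrite big1 // => i _; rewrite r1 /prox_term subrr mul0r expr0n mulr0.
Qed.

Lemma invariant_barrier_gt0 st : ipm_invariant st -> 0 < barrier st.
Proof.
by case=> _ _ -> /andP[nu_gt0 _] _ _ _ _; rewrite mulr_gt0 ?exprn_gt0.
Qed.

Lemma scaled_vec_sqr st (i : 'I_n) : ipm_invariant st ->
  (scaled_vec (primal_var st) (slack_var st) (barrier st)) i 0 ^+ 2 = ratio st i.
Proof.
move=> inv; rewrite mxE sqr_sqrtr //.
by have := inv_ratio inv i; rewrite /ratio; lra.
Qed.

Lemma invariant_scaling st : ipm_invariant st ->
  scaling_defined (primal_var st) (slack_var st) (barrier st).
Proof.
move=> inv; split=> [|i]; first by rewrite gt_eqF ?invariant_barrier_gt0.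
have t_gt := inv_ratio inv i.
split; first by move: t_gt; rewrite /ratio; lra.
by rewrite scaled_vec_sqr // gt_eqF //; lra.
Qed.

Lemma invariant_newton st : ipm_invariant st ->
  exists d, unique (newton_system A b c xi theta st) d.
Proof.
move=> inv; have := inv_primal_gt0 inv; have := inv_slack_gt0 inv.
case: st inv => x y s mu nu inv /= s_gt0 x_gt0.
have [d [dsol duniq]] := newton_direction_unique
  ((theta * nu) *: dual_residual0 c xi) ((theta * nu) *: primal_residual0 A b xi)
  (fun i => mu * (scaled_vec x s mu) i 0 * (search_rhs (scaled_vec x s mu)) i 0)
  rankA x_gt0 s_gt0.
exists d; split=> [|d' d'sol]; first by case: d dsol {duniq} => -[].
by apply: duniq; case: d' d'sol => -[].
Qed.

Variables (xopt : 'cV[R]_n) (yopt : 'cV[R]_m) (sopt : 'cV[R]_n).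
Hypothesis xopt_opt : primal_optimal A b c xopt.
Hypothesis yopt_opt : dual_optimal A b c yopt sopt.
Hypothesis opt_bound : `|col_mx xopt sopt| <= xi.

Let xopt_bound i : 0 <= xopt i 0 <= xi.
Proof.
case: xopt_opt => -[_ x_ge0] _; rewrite x_ge0 /=; apply: le_trans opt_bound.
apply: le_trans (coord_le_norm _ (lshift n i)).
by rewrite col_mxEu ler_norm.
Qed.

Let sopt_bound i : 0 <= sopt i 0 <= xi.
Proof.
case: yopt_opt => -[_ s_ge0] _; rewrite s_ge0 /=; apply: le_trans opt_bound.
apply: le_trans (coord_le_norm _ (rshift n i)).
by rewrite col_mxEd ler_norm.
Qed.

Let Axopt : A *m xopt = b. Proof. by case: xopt_opt => -[]. Qed.
Let Ayopt : A^T *m yopt + sopt = c. Proof. by case: yopt_opt => -[]. Qed.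

Lemma null_row_orthogonal (u : 'cV[R]_n) (y : 'cV[R]_m) (w : 'cV[R]_n) :
  A *m u = 0 -> w = A^T *m y -> \sum_i u i 0 * w i 0 = 0.
Proof.
move=> Au ->; rewrite -/(dotv u (A^T *m y)) dotvC dotv_trmx Au.
by rewrite /dotv big1 // => i _; rewrite mxE mulr0.
Qed.

(** The iterate and the point [nu xi e + (1 - nu) xopt] have the same primal residual [nu r_b^0], so
    their difference lies in the kernel of [A]; likewise the slack difference lies in the row space.
    The starting value [y = 0] contributes nothing to the dual combination. *)
Lemma iterate_orthogonal st : ipm_invariant st ->
  let nu := residual_scale st in
  \sum_i (nu * xi + (1 - nu) * xopt i 0 - primal_var st i 0) *
         (nu * xi + (1 - nu) * sopt i 0 - slack_var st i 0) = 0.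
Proof.
case: st => x y s mu nu [/= _ _ _ _ rb rc _ _].
apply: etrans (@null_row_orthogonal (nu *: (xi *: allone R n) + (1 - nu) *: xopt - x)
   (y - (1 - nu) *: yopt) (nu *: (xi *: allone R n) + (1 - nu) *: sopt - s) _ _).
- by apply: eq_bigr => i _; rewrite !mxE !mulr1.
- rewrite mulmxBr mulmxDr -!scalemxAr Axopt.
  move: rb; rewrite /primal_residual0; move: (A *m x) (A *m allone R n) => Ax Ae.
  by move=> /colP rb; apply/colP => i; have := rb i; rewrite !mxE; lra.
- rewrite mulmxBr -scalemxAr.
  move: rc Ayopt; rewrite /dual_residual0; move: (A^T *m y) (A^T *m yopt) => Ay Ays.
  move=> /colP rc /colP rs; apply/colP => i; have := rc i; have := rs i.
  by rewrite !mxE => <-; lra.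
Qed.

(** Since [r_b^0 = A (xopt - xi e)], the first factor lies in the kernel of [A]; since
    [r_c^0 = A^T yopt + sopt - xi e], the second lies in the row space. *)
Lemma step_orthogonal nu (dx ds : 'cV[R]_n) (dy : 'cV[R]_m) :
    A *m dx = (theta * nu) *: primal_residual0 A b xi ->
    A^T *m dy + ds = (theta * nu) *: dual_residual0 c xi ->
  \sum_i (dx i 0 - theta * nu * (xopt i 0 - xi)) *
         (ds i 0 - theta * nu * (sopt i 0 - xi)) = 0.
Proof.
move=> Adx Ady.
apply: etrans (@null_row_orthogonal (dx - (theta * nu) *: (xopt - xi *: allone R n))
   ((theta * nu) *: yopt - dy) (ds - (theta * nu) *: (sopt - xi *: allone R n)) _ _).
- by apply: eq_bigr => i _; rewrite !mxE !mulr1.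
- by rewrite mulmxBr -!scalemxAr mulmxBr -scalemxAr Axopt Adx subrr.
- rewrite mulmxBr -scalemxAr.
  move: Ady Ayopt; rewrite /dual_residual0; move: (A^T *m dy) (A^T *m yopt) => Ay Ays.
  move=> /colP rc /colP rs; apply/colP => i; have := rc i; have := rs i.
  rewrite !mxE => <-.
  move=> /eqP; rewrite -subr_eq0 => /eqP h; apply/eqP; rewrite -subr_eq0 -h.
  by apply/eqP; ring.
Qed.

Let theta01 : 0 < theta < 1.
Proof.
have N4 : (4 : R) <= n%:R by rewrite ler_nat.
by rewrite divr_gt0 ?ltr_pdivrMr ?mulr_gt0 //; lra.
Qed.

Lemma invariant_step st d : ipm_invariant st ->
    newton_system A b c xi theta st d ->
  let st' := ipm_update theta st d in
  ipm_invariant st' /\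
  dotv (primal_var st') (slack_var st') <= barrier st * (n%:R + 1 / 25).
Proof.
move=> inv; have mu_gt0 := invariant_barrier_gt0 inv.
have := scaled_vec_sqr (st := st) ^~ inv; have := iterate_orthogonal inv.
case: st inv mu_gt0 => x y s mu nu [].
rewrite /ratio /= => x_gt0 s_gt0 muE nu01 rb rc t_gt prox mu_gt0 orth vE.
case: d => -[dx dy] ds [Adx Ady sol] /=.
have [th_gt0 th_lt1] := andP theta01; have [nu_gt0 nu_le1] := andP nu01.
pose t i := x i 0 * s i 0 / mu.
pose al i := dx i 0 / x i 0; pose be i := ds i 0 / s i 0.
have al_be i : al i + be i = (1 - t i) / (2 * t i - 1).
  have q_neq0 : 2 * t i - 1 != 0 by have ti := t_gt i; rewrite gt_eqF // /t; lra.
  have := sol i; rewrite [(search_rhs _) i 0]mxE.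
  (* Factoring out [v] turns [v p_v] into an expression in [v^2 = t], so that no square root
     remains. *)
  rewrite (_ : forall v : R, v - v ^+ 3 = v * (1 - v ^+ 2)); last by move=> v; ring.
  rewrite mulrA [mu * _ * _]mulrA -[mu * _ * _]mulrA -expr2 vE -/(t i) => h.
  have -> : al i + be i = (s i 0 * dx i 0 + x i 0 * ds i 0) / (x i 0 * s i 0).
    by rewrite /al /be; field; rewrite !gt_eqF.
  rewrite h (_ : mu * t i = x i 0 * s i 0); last by rewrite /t mulrC divfK // gt_eqF.
  by field; rewrite q_neq0 !gt_eqF.
pose phi i := theta * nu * (xopt i 0 - xi) / x i 0.
pose ga i := theta * nu * (sopt i 0 - xi) / s i 0.
have E_le : \sum_i t i * (al i ^+ 2 + be i ^+ 2) <= 1 / 10.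
  have pt i : t i * (al i ^+ 2 + be i ^+ 2) <= 3 / 2 * prox_term (t i)
      + 6 * (t i * (phi i ^+ 2 + ga i ^+ 2))
      - 3 * (t i * ((al i - phi i) * (be i - ga i))).
    rewrite /prox_term -al_be; apply: rel_step_bound.
    by have := t_gt i; rewrite -/(t i); lra.
  have := @ler_sum _ _ (index_enum 'I_n) xpredT _ _ (fun i _ => pt i).
  rewrite sumrB big_split /= -!mulr_sumr.
  have -> : \sum_i t i * ((al i - phi i) * (be i - ga i)) = 0.
    (* The weight [t = x s / mu] cancels the relative scaling, which leaves [step_orthogonal] up to
       the factor [1 / mu]. *)
    rewrite (eq_bigr (fun i => mu^-1 * ((dx i 0 - theta * nu * (xopt i 0 - xi)) *
         (ds i 0 - theta * nu * (sopt i 0 - xi))))) => [|i _]; last first.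
      by rewrite /t /al /be /phi /ga; field; rewrite !gt_eqF.
    by rewrite -mulr_sumr (step_orthogonal Adx Ady) mulr0.
  have : \sum_i t i * (phi i ^+ 2 + ga i ^+ 2) <= 115 / 10000.
    rewrite /t muE; apply: target_sum_le => // [i|i].
      split=> //; exact: complementary_slackness xopt_opt yopt_opt i.
    rewrite -muE; apply: prox_term_small => //; apply: le_trans prox.
    rewrite [leRHS](bigD1 i) //= lerDl sumr_ge0 // => j _; apply: prox_term_ge0.
    by have := t_gt j; lra.
  (* The total is [3/2 1/50 + 6 115/10000 = 99/1000]. *)
  have := prox; rewrite -/(\sum_i prox_term (t i)).
  by move=> *; lra.
have t'E i : (x + dx) i 0 * (s + ds) i 0 / ((1 - theta) * mu) =
    t i * ((1 + al i) * (1 + be i)) / (1 - theta).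
  rewrite !mxE /t /al /be; field.
  by rewrite !gt_eqF // subr_gt0.
have pos i := step_positive n_ge4 t_gt prox al_be E_le i.
have nu'_gt0 : 0 < (1 - theta) * nu by rewrite mulr_gt0 // subr_gt0.
split; first split=> /=.
- move=> i; have -> : (x + dx) i 0 = x i 0 * (1 + al i).
    by rewrite mxE /al; field; rewrite gt_eqF.
  by rewrite mulr_gt0 //; case: (pos i).
- move=> i; have -> : (s + ds) i 0 = s i 0 * (1 + be i).
    by rewrite mxE /be; field; rewrite gt_eqF.
  by rewrite mulr_gt0 //; case: (pos i).
- by rewrite muE mulrA.
- by rewrite nu'_gt0 /=; nra.
- rewrite mulmxDr Adx; move: rb; move: (A *m x) (primal_residual0 _ _ _) => Ax r.
  by move=> /colP rb; apply/colP => i; have := rb i; rewrite !mxE; lra.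
- move: rc Ady; rewrite mulmxDr.
  move: (A^T *m y) (A^T *m dy) (dual_residual0 _ _) => Ay Ady r.
  move=> /colP rc /colP rd; apply/colP => i; have := rc i; have := rd i.
  by rewrite !mxE; lra.
- move=> i; rewrite /ratio /= t'E.
  exact: (step_ratio_gt n_ge4 t_gt prox al_be E_le i).
- rewrite /ratio /=; under eq_bigr do rewrite t'E.
  exact: (step_prox n_ge4 t_gt prox al_be E_le).
have -> : dotv (x + dx) (s + ds) =
    mu * \sum_i (1 - theta) * (t i * ((1 + al i) * (1 + be i)) / (1 - theta)).
  rewrite mulr_sumr; apply: eq_bigr => i _; rewrite -t'E; field.
  by rewrite !gt_eqF // subr_gt0.
rewrite ler_pM2l //; exact: (step_gap n_ge4 t_gt prox al_be).
Qed.
End Invariant.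

(* With L = log (initial error / eps), the bound k <= 22 n L is asserted as is
   for L >= 6.  It fails for small L: for A = (1 1 1 1), b = 4, c = e, xi = 1
   the first iteration only updates mu and nu, so that for 0 < L < 2 more than
   22 n L iterations are needed; for L < 0 it is negative.  For all L the
   iteration count is below 22 n max(0, L) + 3. *)
Theorem theorem5 (R : realType) (m n : nat)
    (A : 'M[R]_(m, n)) (b : 'cV[R]_m) (c : 'cV[R]_n) (xi eps : R)
    (rankA : \rank A = m) (n_ge4 : (4 <= n)%N)
    (P_feasible : exists x, primal_feasible A b x)
    (D_feasible : exists y s, dual_feasible A c y s)
    (xi_gt0 : 0 < xi)
    (xi_bound : exists xopt yopt sopt,
        [/\ primal_optimal A b c xopt, dual_optimal A b c yopt sopt
          & `|col_mx xopt sopt| <= xi])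
    (eps_gt0 : 0 < eps) :
  let inp := IpmInput eps (1 / (22 * n%:R)) (1 / 12) in
  let L := ln (initial_error A b c xi / eps) in
  exists k (u : nat -> ipm_state R m n),
    [/\ ipm_halts_after A b c xi inp k u,
        eps_optimal A b c eps
          (primal_var (u k)) (dual_var (u k)) (slack_var (u k)),
        6 <= L -> k%:R <= 22 * n%:R * L
      & k%:R < 22 * n%:R * Num.max 0 L + 3].
Proof.
move=> inp L.
have [xopt [yopt [sopt [xopt_opt yopt_opt opt_bound]]]] := xi_bound.
pose N : R := n%:R; pose theta : R := 1 / (22 * N).
have N_ge4 : 4 <= N by rewrite ler_nat.
have theta_N : 22 * N * theta = 1.
  by rewrite /theta mul1r mulfV // mulf_neq0 // gt_eqF //; lra.
have theta_gt0 : 0 < theta by rewrite divr_gt0 // mulr_gt0 //; lra.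
have theta_le : theta <= 1 / 88 by nra.
(* Choice turns the iteration into a total function that can be iterated; outside the invariant the
   witness is the state itself. *)
have /boolp.choice[step stepP] : forall st, exists st',
    ipm_invariant A b c xi st ->
    [/\ ipm_invariant A b c xi st',
        ipm_iteration A b c xi theta st st',
        residual_scale st' = (1 - theta) * residual_scale st
      & dotv (primal_var st') (slack_var st')
          <= barrier st * (N + 1 / 25)].
  move=> st.
  have [inv|ninv] := pselect (ipm_invariant A b c xi st); last by exists st.
  have [d d_unique] := invariant_newton rankA inv.
  exists (ipm_update theta st d) => _.
  have [inv' gap] := invariant_step n_ge4 xi_gt0 xopt_opt yopt_opt opt_bound
    inv (proj1 d_unique).
  split=> //.
    split; first exact: invariant_scaling inv.
    by exists d.
  by case: (st) (d) => x y s mu nu [[]].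
pose u j := iter j step (ipm_init m n xi).
have inv j : ipm_invariant A b c xi (u j).
  by elim: j => [|j IHj]; [exact: invariant_init|case: (stepP _ IHj)].
have scale j : residual_scale (u j) = (1 - theta) ^+ j.
  elim: j => [|j IHj]; first by rewrite expr0.
  by rewrite exprS -IHj; case: (stepP _ (inv j)).
pose E0 := initial_error A b c xi.
have E0_gt0 : 0 < E0.
  rewrite /E0 /initial_error lt_max mulr_gt0 ?exprn_gt0 //.
  by rewrite -/N; lra.
have rho_gt0 : 0 < 1 + 1 / (25 * N) by rewrite ltr_pwDl // divr_ge0 // mulr_ge0 //; lra.
(* State [j.+1] is compared with the power [j], since the gap is bounded through the previous
   barrier; the last factor is [(N + 1/25) / N]. *)
have error_le j : eps_optimal A b c ((1 - theta) ^+ j * E0 * (1 + 1 / (25 * N)))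
    (primal_var (u j.+1)) (dual_var (u j.+1)) (slack_var (u j.+1)).
  have pow_ge0 k : 0 <= (1 - theta) ^+ k by rewrite exprn_ge0 //; lra.
  have [_ _ _ gap] := stepP _ (inv j).
  have resid_le (r : R) : 0 <= r -> r <= E0 ->
      (1 - theta) ^+ j.+1 * r <= (1 - theta) ^+ j * E0 * (1 + 1 / (25 * N)).
    move=> r_ge0 r_le; apply: le_trans (_ : (1 - theta) ^+ j * E0 <= _).
      rewrite exprS -mulrA [leRHS]mulrC -[leRHS]mul1r [E0 * _]mulrC.
      by apply: ler_pM; rewrite ?mulr_ge0 ?ler_wpM2l //; lra.
    apply: ler_peMr; first by rewrite mulr_ge0 // ltW.
    by rewrite lerDl divr_ge0 // mulr_ge0 //; lra.
  rewrite /eps_optimal !ge_max; apply/and3P; split.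
  - apply: le_trans gap _; rewrite (inv_barrier (inv j)) scale.
    have -> : (1 - theta) ^+ j * xi ^+ 2 * (N + 1 / 25) =
        (1 - theta) ^+ j * (N * xi ^+ 2) * (1 + 1 / (25 * N)).
      by field; rewrite gt_eqF //; lra.
    apply: ler_wpM2r; first exact: ltW.
    by rewrite ler_wpM2l // /E0 /initial_error le_max lexx.
  - rewrite (inv_primal_residual (inv j.+1)) scale enormZ //.
    by apply: resid_le; rewrite ?sqrtr_ge0 // /E0 /initial_error !le_max lexx orbT.
  - rewrite (inv_dual_residual (inv j.+1)) scale enormZ //.
    by apply: resid_le; rewrite ?sqrtr_ge0 // /E0 /initial_error !le_max lexx !orbT.
pose stop j := stopping_test A b c eps (u j).
(* Logarithms of [error_le], multiplied by [22 N]; the constant 22/25 is [22 N] times the bound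
   [1 / (25 N)] on the logarithm of the last factor. *)
have index_lt j : ~ stop j.+1 -> j%:R * (1 + theta / 2) < 22 * N * L + 22 / 25.
  move=> nstop.
  have eps_lt : eps < (1 - theta) ^+ j * E0 * (1 + 1 / (25 * N)).
    rewrite ltNge; apply/negP => le_eps; apply: nstop.
    exact: le_trans (error_le j) le_eps.
  have omt_gt0 : 0 < 1 - theta by lra.
  have pow_gt0 : 0 < (1 - theta) ^+ j by rewrite exprn_gt0.
  have : ln eps < ln (1 - theta) * j%:R + ln E0 + ln (1 + 1 / (25 * N)).
    rewrite mulr_natr -lnXn // -!lnM ?posrE ?mulr_gt0 //.
    by rewrite ltr_ln ?posrE ?mulr_gt0.
  have -> : ln E0 = L + ln eps.
    by rewrite /L ln_div ?posrE // subrK.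
  have : ln (1 + 1 / (25 * N)) <= 1 / (25 * N).
    apply: le_ln1Dx; apply: lt_le_trans (_ : 0 <= _); first lra.
    by rewrite divr_ge0 // mulr_ge0 //; lra.
  have : ln (1 - theta) * j%:R <= (- theta - theta ^+ 2 / 2) * j%:R.
    by apply: ler_wpM2r => //; apply: ln1B_le; apply/andP; split; lra.
  have -> : 1 / (25 * N) = 22 / 25 * theta.
    by rewrite /theta; field; rewrite gt_eqF //; lra.
  move=> h1 h2 h3.
  have : j%:R * (theta + theta ^+ 2 / 2) < L + 22 / 25 * theta by lra.
  rewrite -(ltr_pM2l (_ : 0 < 22 * N)); last lra.
  have -> : 22 * N * (j%:R * (theta + theta ^+ 2 / 2)) =
    (22 * N * theta) * (j%:R * (1 + theta / 2)) by field.
  have -> : 22 * N * (L + 22 / 25 * theta) = 22 * N * L + 22 / 25 * (22 * N * theta).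
    by field.
  by rewrite theta_N mul1r mulr1.
have ex_stop : exists k, (fun k => `[< stop k >]) k.
  pose K := Num.bound (22 * N * Num.max 0 L + 22 / 25).
  exists K.+1; apply/asboolP; apply: contrapT => /index_lt.
  have L_le : 22 * N * L <= 22 * N * Num.max 0 L.
    by rewrite ler_wpM2l ?le_max ?lexx ?orbT // mulr_ge0 //; lra.
  have : 22 * N * Num.max 0 L + 22 / 25 < K%:R.
    apply: archi_boundP; rewrite addr_ge0 ?mulr_ge0 ?le_max ?lexx //; lra.
  have : 0 <= K%:R * (theta / 2) by rewrite mulr_ge0 //; lra.
  by lra.
case: (ex_minnP ex_stop) => k /asboolP stop_k k_min.
have nstop j : (j < k)%N -> ~ stop j.
  by move=> jk sj; have := k_min j (asboolT sj); rewrite leqNgt jk.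
exists k, u; split=> //.
- split=> // j jk; split; first exact: nstop.
  by case: (stepP _ (inv j)).
- move=> L_ge6.
  have NL : 22 * N * 6 <= 22 * N * L by rewrite ler_wpM2l //; lra.
  (* From two iterations on, [index_lt] applies to the last state that failed the test, whose index
     is one less than the count. *)
  case: k {stop_k k_min} nstop => [_|[_|k nstop]].
  + by rewrite -/N; lra.
  + by rewrite -/N; lra.
  rewrite leNgt; apply/negP => k_gt.
  have := index_lt k (nstop _ (ltnSn _)).
  have : (22 * N * L - 2) * (1 + theta / 2) <= k%:R * (1 + theta / 2).
    apply: ler_wpM2r; first lra.
    by move: k_gt; rewrite -/N -addn2 natrD; lra.
  (* The term [L / 2 >= 3] outweighs [2 + theta + 22/25], as [theta <= 1/88]. *)
  have -> : (22 * N * L - 2) * (1 + theta / 2) =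
      22 * N * L - 2 - theta + (22 * N * theta) * L / 2 by field.
  by rewrite theta_N; lra.
have maxL_ge0 : 0 <= 22 * N * Num.max 0 L.
  by rewrite !mulr_ge0 ?le_max ?lexx //; lra.
have L_le : 22 * N * L <= 22 * N * Num.max 0 L.
  by rewrite ler_wpM2l ?le_max ?lexx ?orbT //; lra.
case: k {stop_k k_min} nstop => [_|[_|k nstop]].
- by rewrite -/N; lra.
- by rewrite -/N; lra.
(* With count [k.+2], the excess over [22 N max(0, L)] is below 2 + 22/25, hence below 3. *)
have := index_lt k (nstop _ (ltnSn _)).
have : 0 <= k%:R * (theta / 2) by rewrite mulr_ge0 //; lra.
by rewrite -/N -[k.+2]addn2 natrD; lra.
Qed.
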